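(* Suppose Assumption (G) holds. Let $f^n\overset{D}{\to}f^\dagger$ in $Y$ as $n\to\infty$, put $\delta_i^n=D_i(f_i^\dagger,f_i^n)$ for $i\in\{1,\dots,N\}$, and let $\lambda^n\in(0,\infty)^N$ be such that $\lambda_i^n\to\infty$ and $\lambda_i^n\delta_i^n\to0$ for all $i$. Let $(u^n)_n$ be a sequence of solutions to $\min_{u\in\operatorname{dom}(T)}J_{\lambda^n}(u,f^n)$ and let $u^\dagger$ be an $R$-minimizing solution of $Tu=f^\dagger$ such that, for some $n_0$, condition $S_2(U_{n_0},f^\dagger)$ holds with functions $\psi_i$, where $U_{n_0}=\{u^n: n\ge n_0\}\cup\{u^\dagger\}$. Then there is $C>0$ such that for all but finitely many $n$ $$R(u^n)\le R(u^\dagger)+C\sum_{i=1}^N\lambda_i^n\delta_i^n.$$ If, further, there exist $\xi\in\partial R(u^\dagger)$ and constants $0<\beta_1<1$, $0<\beta_2$ such that $$-\langle\xi,u-u^\dagger\rangle\le\beta_1D_R^\xi(u,u^\dagger)+\beta_2\sum_{i=1}^ND_i(T_iu,T_iu^\dagger)$$ for all $u$ satisfying $R(u)+\sum_{i=1}^ND_i(T_iu,f_i^\dagger)\le R(u^\dagger)+\epsilon$ for some $\epsilon>0$, then for any $j\in\{1,\dots,N\}$ $$D_R^\xi(u^n,u^\dagger)=O\Big(\sum_{i=1}^N\big(\lambda_i^n\delta_i^n+\psi_i(\delta_i^n)\big)\Big),$$ $$D_j(T_ju^n,f_j^n)=O\Big((\lambda_j^n)^{-1}\sum_{i=1}^N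\big(\lambda_i^n\delta_i^n+\psi_i(\delta_i^n)\big)\Big).$$
   Context: Setting. Let $(X,\|\cdot\|_X)$ be a Banach space and $R\colon X\to[0,\infty]$. For $i=1,\dots,N$ let $(Y_i,\|\cdot\|_{Y_i})$ be a normed space, $D_i\colon Y_i\times Y_i\to[0,\infty]$ a data discrepancy and $T_i\colon \operatorname{dom}(T_i)\subset X\to Y_i$ an operator. Put $\operatorname{dom}(T)=\bigcap_{i=1}^N\operatorname{dom}(T_i)$, $Y=Y_1\times\cdots\times Y_N$ and $Tu=(T_1u,\dots,T_Nu)$. For $u\in\operatorname{dom}(T)$, $f\in Y$ and $\lambda\in(0,\infty)^N$ let $$J_\lambda(u,f)=\sum_{i=1}^N\lambda_iD_i(T_iu,f_i)+R(u).$$ An $R$-minimizing solution of $Tu=f^\dagger$ is a minimizer of $R$ over $\{u\in\operatorname{dom}(T):Tu=f^\dagger\}$ at which $R$ is finite. In expressions involving $T_iu$, $u$ ranges over $\operatorname{dom}(T)$. $\xi\in\partial R(u)\subset X^*$ means $R(u)<\infty$ and $R(v)\ge R(u)+\langle\xi,v-u\rangle$ for all $v\in X$; the Bregman distance is $D_R^\xi(v,u)=R(v)-R(u)-\langle\xi,v-u\rangle$. For sequences, $x^n=O(y^n)$ means there is $C>0$ with $x^n\le Cy^n$ for all sufficiently large $n$. Let $\tau_X$ be a Hausdorff topology on $X$, and for each $i$ let $\tau_{Y_i}$ (Hausdorff) and $\tau_{D_i}$ (arbitrary) be topologies on $Y_i$. Write $f_i^n\overset{D_i}{\to}f_i$ if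 $D_i(f_i,f_i^n)\to0$ and $f_i^n\to f_i$ in $\tau_{D_i}$ as $n\to\infty$; $f^n\overset{D}{\to}f$ means this holds for every component. Assumption (G): (1) For each $i$ and $a,b\in Y_i$, $D_i(a,b)=0$ implies $a=b$. (2) For each $i$: if $a^n\to a$ in $\tau_{Y_i}$ and $f_i^n\overset{D_i}{\to}f_i$, then $D_i(a,f_i)\le\liminf_{n\to\infty}D_i(a^n,f_i^n)$. (3) $R$ is lower semi-continuous w.r.t. $\tau_X$. (4) Each $T_i$ is continuous from $(X,\tau_X)$ (on $\operatorname{dom}(T_i)$) to $(Y_i,\tau_{Y_i})$ and $\operatorname{dom}(T_i)$ is closed w.r.t. convergence in $\tau_X$. (5) For any $\lambda\in(0,\infty)^N$: whenever $f^n\overset{D}{\to}f$ and $J_\lambda(u^n,f^n)<c$ for all $n$ and some constant $c$, the sequence $(u^n)_n$ admits a $\tau_X$-convergent subsequence. Condition $S_2(U,f^\dagger)$ (for $U\subset\operatorname{dom}(T)$): for each $i$ there are a continuous increasing function $\psi_i\colon[0,\infty)\to[0,\infty)$ with $\psi_i(0)=0$, a set $V_i\in\tau_{D_i}$ with $f_i^\dagger\in V_i$, and $\alpha>0$ such that for each $v\in U$ and each $f_i\in V_i$ with $D_i(f_i^\dagger,f_i)<\alpha$, $$D_i(T_iv,f_i)\le D_i(T_iv,f_i^\dagger)\big(1+\psi_i(D_i(f_i^\dagger,f_i))\big)+\psi_i(D_i(f_i^\dagger,f_i)),$$ $$D_i(T_iv,f_i)\ge D_i(T_iv,f_i^\dagger)\big(1-\psi_i(D_i(f_i^\dagger,f_i))\big)-\psi_i(D_i(f_i^\dagger,f_i)).$$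 *)

(* Defs.v *)
From HB Require Import structures.
From mathcomp Require Export all_boot all_order all_algebra.
From mathcomp Require Export all_classical all_reals all_analysis.
Export Order.TTheory GRing.Theory Num.Theory.
Export numFieldNormedType.Exports.

Set Implicit Arguments.
Unset Strict Implicit.
Unset Printing Implicit Defensive.

Local Open Scope classical_set_scope.
Local Open Scope ring_scope.

(* The carrier of [X] equipped with the topology [t], which is in general
   unrelated to the norm topology of [X]. *)
Definition withTop (X : Type) (t : Topological X) : topologicalType :=
  Topological.Pack t.

(* Operators [T i] are total functions; their values outside [domT i] are
   junk and are never used. *)
Definition domain (N : nat) (X : Type) (domT : 'I_N -> set X) : set X :=
  \bigcap_(i in [set: 'I_N]) domT i.

Section Functionals.
Context (K : realType) (N : nat) (X : normedModType K)
  (Y : 'I_N -> normedModType K) (R : X -> \bar K)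
  (D : forall i, Y i -> Y i -> \bar K)
  (domT : 'I_N -> set X) (T : forall i, X -> Y i).
Local Open Scope ereal_scope.

Definition J (lambda : 'I_N -> K) (u : X) (f : forall i, Y i) : \bar K :=
  \sum_(i < N) (lambda i)%:E * D (T i u) (f i) + R u.

Definition is_J_minimizer (lambda : 'I_N -> K) (f : forall i, Y i) (u : X) :
    Prop :=
  domain domT u /\ forall v, domain domT v -> J lambda u f <= J lambda v f.

Definition is_R_minimizing_solution (f : forall i, Y i) (u : X) : Prop :=
  [/\ domain domT u, forall i, T i u = f i, R u < +oo &
      forall v, domain domT v -> (forall i, T i v = f i) -> R u <= R v].

Definition dual_element (xi : {linear X -> K^o}) : Prop :=
  continuous (xi : X -> K^o).

Definition subgradient (u : X) (xi : {linear X -> K^o}) : Prop :=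
  [/\ dual_element xi, R u < +oo & forall v, R u + (xi (v - u)%R)%:E <= R v].

Definition bregman (xi : {linear X -> K^o}) (v u : X) : \bar K :=
  R v - R u - (xi (v - u)%R)%:E.

End Functionals.

Definition Dcvg1 (K : realType) (Yi : normedModType K)
    (Di : Yi -> Yi -> \bar K) (tD : Topological Yi) (f : nat -> Yi) (f0 : Yi) :
    Prop :=
  ((fun n => Di f0 (f n)) @ \oo --> 0%E) /\
  ((f : nat -> withTop tD) @ \oo --> (f0 : withTop tD)).

Definition Dcvg (K : realType) (N : nat) (Y : 'I_N -> normedModType K)
    (D : forall i, Y i -> Y i -> \bar K) (tD : forall i, Topological (Y i))
    (f : nat -> forall i, Y i) (f0 : forall i, Y i) : Prop :=
  forall i, Dcvg1 (D i) (tD i) (fun n => f n i) (f0 i).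

Record assumption_G (K : realType) (N : nat) (X : normedModType K)
    (Y : 'I_N -> normedModType K) (R : X -> \bar K)
    (D : forall i, Y i -> Y i -> \bar K)
    (domT : 'I_N -> set X) (T : forall i, X -> Y i)
    (tX : Topological X) (tY tD : forall i, Topological (Y i)) : Prop := {
  G_definite : forall i (a b : Y i), D i a b = 0%E -> a = b;
  G_liminf : forall i (a : nat -> Y i) (a0 : Y i) (f : nat -> Y i) (f0 : Y i),
    (a : nat -> withTop (tY i)) @ \oo --> (a0 : withTop (tY i)) ->
    Dcvg1 (D i) (tD i) f f0 ->
    (D i a0 f0 <= limn_einf (fun n => D i (a n) (f n)))%E;
  G_lsc : lower_semicontinuous (R : withTop tX -> \bar K);
  G_cont : forall i,
    {within (domT i : set (withTop tX)),
      continuous (T i : withTop tX -> withTop (tY i))};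
  G_closed : forall i (u : nat -> X) (u0 : X), (forall n, domT i (u n)) ->
    (u : nat -> withTop tX) @ \oo --> (u0 : withTop tX) -> domT i u0;
  G_compact : forall lambda : 'I_N -> K, (forall i, 0 < lambda i) ->
    forall (f : nat -> forall i, Y i) (f0 : forall i, Y i) (u : nat -> X)
      (c : K),
    Dcvg D tD f f0 ->
    (forall n, domain domT (u n)) ->
    (forall n, (J R D T lambda (u n) (f n) < c%:E)%E) ->
    exists (k : nat -> nat) (u0 : X),
      {homo k : m n / (m < n)%N} /\
      ((fun n => u (k n) : withTop tX) @ \oo --> (u0 : withTop tX))
}.

(* Continuous, (weakly) increasing functions [0, oo) -> [0, oo) vanishing at 0;
   values on negative arguments are junk. *)
Definition is_modulus (K : realType) (psi : K -> K) : Prop :=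
  [/\ {within `[0, +oo[, continuous psi},
      forall s t, 0 <= s -> s <= t -> psi s <= psi t,
      forall t, 0 <= t -> 0 <= psi t
    & psi 0 = 0].

(* [alpha] is finite, so [fine] is only applied to finite discrepancies. The
   product [+oo * 0] equals [0] in [\bar K]; it can only occur in the last
   inequality when psi_i = 1, which shrinking [alpha] rules out. *)
Definition S2 (K : realType) (N : nat) (X : normedModType K)
    (Y : 'I_N -> normedModType K) (D : forall i, Y i -> Y i -> \bar K)
    (T : forall i, X -> Y i) (tD : forall i, Topological (Y i))
    (psi : 'I_N -> K -> K) (U : set X) (fd : forall i, Y i) : Prop :=
  forall i, is_modulus (psi i) /\
    exists (V : set (Y i)) (alpha : K),
      [/\ open (V : set (withTop (tD i))), V (fd i), 0 < alpha &
        forall (v : X) (fi : Y i), U v -> V fi ->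
          (D i (fd i) fi < alpha%:E)%E ->
          let p := psi i (fine (D i (fd i) fi)) in
          (D i (T i v) fi <= D i (T i v) (fd i) * (1 + p)%:E + p%:E)%E /\
          (D i (T i v) (fd i) * (1 - p)%:E - p%:E <= D i (T i v) fi)%E].

Definition bigO_seq (K : realType) (x y : nat -> \bar K) : Prop :=
  exists2 C : K, 0 < C & \forall n \near \oo, (x n <= C%:E * y n)%E.

(* Main.v *)
Require Import Defs.
From mathcomp Require Import lra.

(** Everything follows from comparing the minimizer [u n] with [ud] in the
    functional with data [f n].  As [T i ud = fd i], this gives
    [\sum_i lambda n i * a i + R (u n) <= \sum_i lambda n i * delta n i + R ud]
    with [a i := D i (T i (u n)) (f n i)] ([minimizer_energy_le]).  Dropping the
    nonnegative sum on the left is the first claim, with constant 1.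

    For the rates, let [d i := D i (T i (u n)) (fd i)] and
    [p i := psi i (delta n i)].  The energy inequality bounds
    [lambda n i * a i], so [a i] tends to 0 since [lambda n i] tends to
    infinity; as soon as [p i <= 1/2], the lower bound in S2 yields
    [d i <= 2 (a i + p i)] ([discrepancy_to_exact_data]), so [d i] tends to 0
    too.  Hence [u n] eventually enters the region where the source condition
    holds.  With [B] the Bregman distance, that condition and the energy
    inequality give
    [(1 - beta1) B + \sum_i lambda n i * a i
       <= \sum_i lambda n i * delta n i + 2 beta2 \sum_i (a i + p i)].
    Since [lambda n i] eventually exceeds [4 beta2], half of the sum on the left
    absorbs the [a i] on the right ([energy_absorbs_discrepancy]), and what
    remains bounds both [B] and each [lambda n j * a j] by the announced
    rate. *)

Local Open Scope classical_set_scope.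
Local Open Scope ring_scope.

Lemma near_lt_of_cvg0 (K : realType) (x : nat -> \bar K) (e : K) :
  x @ \oo --> 0%E -> 0 < e -> \forall n \near \oo, (x n < e%:E)%E.
Proof.
move=> x0 e0; apply: (x0 [set y | (y < e%:E)%E]).
exact: (@nbhs_open_ereal_lt K 0 (fun=> e)).
Qed.

Lemma modulus_small (K : realType) (psi : K -> K) (e : K) :
  is_modulus psi -> 0 < e ->
  exists2 r : K, 0 < r & forall t, 0 <= t -> t < r -> psi t < e.
Proof.
move=> [psic _ _ psi0] e0.
have z0 : [set` `[0, +oo[ : interval K] 0 by rewrite /= in_itv /= lexx.
have /(_ 0 z0) psi_cvg := (subspace_continuousP _ _).1 psic.
have : \forall t \near within [set` `[0, +oo[ : interval K] (nbhs (0 : K)),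
    psi t < e.
  by apply: (cvgr_lt (psi 0) psi_cvg); rewrite psi0.
rewrite /within /= => /nbhs_ballP[r /= r0 rP].
exists r => // t t0 tr; apply: rP; last by rewrite in_itv /= andbT.
by rewrite /ball /= sub0r normrN ger0_norm.
Qed.

(** Replacing noisy by exact data costs only a factor: with [1 - p] at least
    one half, the lower bound in S2 can be solved for [d].  In particular an
    infinite [d] would force [a] to be infinite. *)
Lemma discrepancy_to_exact_data (K : realType) (d a : \bar K) (p : K) :
  (0 <= d)%E -> (a < +oo)%E -> p <= 2^-1 ->
  (d * (1 - p)%:E - p%:E <= a)%E -> (d <= 2%:E * (a + p%:E))%E.
Proof.
move=> d0 afin p2 H.
case: d a d0 afin H => [d| |] [a| |] //=.
- rewrite !lee_fin => d0 _ H; nra.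
- by move=> _ _; rewrite gt0_mulye ?lte_fin; [rewrite addye // leye_eq|lra].
- by move=> _ _; rewrite gt0_mulye ?lte_fin; [rewrite addye // leye_eq|lra].
Qed.

Lemma minimizer_energy_le (K : realType) (N : nat) (X : normedModType K)
    (Y : 'I_N -> normedModType K) (R : X -> \bar K)
    (D : forall i, Y i -> Y i -> \bar K) (domT : 'I_N -> set X)
    (T : forall i, X -> Y i) (lam : 'I_N -> K) (g fd : forall i, Y i)
    (u ud : X) :
  is_J_minimizer R D domT T lam g u ->
  is_R_minimizing_solution R domT T fd ud ->
  (\sum_(i < N) (lam i)%:E * D i (T i u) (g i) + R u <=
   \sum_(i < N) (lam i)%:E * D i (fd i) (g i) + R ud)%E.
Proof.
move=> [_ umin] [ud_dom Tud _ _].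
have := umin _ ud_dom; rewrite /J.
by under [in X in (_ <= X)%E]eq_bigr do rewrite Tud.
Qed.

(** The weights dominate the constant of the source condition:
    [b2 * d i <= 2 * b2 * (a i + p i)], and [2 * b2 * a i] is at most half of
    [lam i * a i]. *)
Lemma energy_absorbs_discrepancy (K : realFieldType) (N : nat)
    (lam p a d s : 'I_N -> K) (r rd x b1 b2 : K) :
  0 < b2 -> (forall i, 0 <= a i) -> (forall i, 4 * b2 <= lam i) ->
  (forall i, d i <= 2 * (a i + p i)) ->
  \sum_i lam i * a i + r <= \sum_i s i + rd ->
  - x <= b1 * (r - rd - x) + b2 * \sum_i d i ->
  (1 - b1) * (r - rd - x) + 2^-1 * (\sum_i lam i * a i) <=
    \sum_i s i + 2 * b2 * \sum_i p i.
Proof.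
move=> b20 a0 lamb dle Hen Hsrc.
have : b2 * \sum_i d i <= 2^-1 * (\sum_i lam i * a i) + 2 * b2 * \sum_i p i.
  rewrite !mulr_sumr -big_split /=; apply: ler_sum => i _.
  have := a0 i; have := lamb i; have := dle i; nra.
lra.
Qed.

(** The whole argument for one fixed index of the sequence.  The bounds that
    involve [e] serve only to place the point in the region where the source
    condition is assumed; the constants in the conclusion depend on [b1] and
    [b2] alone. *)
Lemma error_bounds_of_energy (K : realType) (N : nat) (lam p : 'I_N -> K)
    (a d dl : 'I_N -> \bar K) (r rd : \bar K) (x b1 b2 e eps : K) :
  (forall i, 0 < lam i) -> (forall i, 0 <= p i) ->
  (forall i, (0 <= a i)%E) -> (forall i, (0 <= d i)%E) ->
  (forall i, (0 <= dl i)%E) -> (0 <= r)%E -> (0 <= rd)%E -> (rd < +oo)%E ->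
  b1 < 1 -> 0 < b2 ->
  (\sum_i (lam i)%:E * a i + r <= \sum_i (lam i)%:E * dl i + rd)%E ->
  (forall i, d i * (1 - p i)%:E - (p i)%:E <= a i)%E ->
  (forall i, p i <= 2^-1) -> (forall i, 4 * p i <= e) ->
  (forall i, (lam i)%:E * dl i <= e%:E)%E ->
  (forall i, 4 * b2 <= lam i) ->
  (forall i, 4 * (fine rd + N%:R * e) <= lam i * e) ->
  2 * N%:R * e <= eps ->
  ((r + \sum_i d i <= rd + eps%:E)%E ->
   ((- x)%:E <= b1%:E * (r - rd - x%:E) + b2%:E * \sum_i d i)%E) ->
  (0 <= r - rd - x%:E)%E ->
  let rate := (\sum_i ((lam i)%:E * dl i + (p i)%:E))%E in
  (r - rd - x%:E <= ((1 + 2 * b2) / (1 - b1))%:E * rate)%E /\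
  forall j, (a j <= (2 * (1 + 2 * b2))%:E * ((lam j)^-1%:E * rate))%E.
Proof.
move=> lam0 p0 a0 d0 dl0 r0 rd0 rdfin b11 b20 Hen Hst p2 pe sle
  lamb lame Neps Hsrc B0 rate; rewrite {}/rate.
have Lgt0 i : (0 < (lam i)%:E)%E by rewrite lte_fin.
(* All quantities are finite, so the rest of the proof takes place in [K]. *)
have [s sE] : exists s : 'I_N -> K, forall i, ((lam i)%:E * dl i)%E = (s i)%:E.
  exists (fun i => fine ((lam i)%:E * dl i)%E) => i; rewrite fineK//.
  rewrite ge0_fin_numE; last by rewrite mule_ge0// ltW.
  exact: le_lt_trans (sle i) (ltry _).
have s0 i : 0 <= s i by rewrite -lee_fin -sE mule_ge0// ltW.
have {}sle i : s i <= e by rewrite -lee_fin -sE.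
have [rd' rdE] : exists rd', rd = rd'%:E.
  by exists (fine rd); rewrite fineK// ge0_fin_numE.
subst rd; rewrite /= in lame.
move: Hen; under [in X in (_ <= X)%E]eq_bigr do rewrite sE.
rewrite sumEFin -EFinD => Hen.
have La0 i : (0 <= (lam i)%:E * a i)%E by rewrite mule_ge0// ltW.
have suma0 : (0 <= \sum_i (lam i)%:E * a i)%E by exact: sume_ge0.
have [r' rE] : exists r', r = r'%:E.
  exists (fine r); rewrite fineK// ge0_fin_numE//.
  apply: le_lt_trans (le_trans _ Hen) (ltry _); exact: leeDr.
subst r.
have [a' aE] : exists a' : 'I_N -> K, forall i, a i = (a' i)%:E.
  exists (fun i => fine (a i)) => i; rewrite fineK// ge0_fin_numE//.
  have lai : ((lam i)%:E * a i < +oo)%E.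
    apply: le_lt_trans (le_trans _ Hen) (ltry _).
    rewrite (bigD1 i)//= -addeA leeDl// adde_ge0//; exact: sume_ge0.
  case: (a i) (a0 i) lai => [z| |]//= _.
    by move=> _; rewrite ltry.
  by rewrite gt0_muley.
have {}a0 i : 0 <= a' i by rewrite -lee_fin -aE.
have dle i : (d i <= (2 * (a' i + p i))%:E)%E.
  have afin : (a i < +oo)%E by rewrite aE ltry.
  have := discrepancy_to_exact_data _ _ _ _ (d0 i) afin (p2 i) (Hst i).
  by rewrite aE.
have [d' dE] : exists d' : 'I_N -> K, forall i, d i = (d' i)%:E.
  exists (fun i => fine (d i)) => i; rewrite fineK// ge0_fin_numE//.
  exact: le_lt_trans (dle i) (ltry _).
have {}dle i : d' i <= 2 * (a' i + p i) by rewrite -lee_fin -dE.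
have sumdE : (\sum_i d i = (\sum_i d' i)%:E)%E.
  by rewrite -sumEFin; apply: eq_bigr => i _; rewrite dE.
have sumaE : (\sum_i (lam i)%:E * a i = (\sum_i lam i * a' i)%:E)%E.
  by rewrite -sumEFin; apply: eq_bigr => i _; rewrite aE EFinM.
move: Hen Hsrc.
rewrite sumdE sumaE -!(EFinB, EFinD, EFinM) !lee_fin => Hen Hsrc.
rewrite -!EFinB lee_fin in B0.
have lale i : lam i * a' i <= \sum_i lam i * a' i.
  rewrite (bigD1 i)//= lerDl sumr_ge0// => k _.
  by rewrite mulr_ge0// ltW.
have sumNe (z : 'I_N -> K) : (forall i, z i <= e) -> \sum_i z i <= N%:R * e.
  move=> ze; apply: le_trans (ler_sum _ (fun i _ => ze i)) _.
  by rewrite sumr_const card_ord mulr_natl.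
have sums := sumNe _ sle.
have r'0 : 0 <= r' by rewrite -lee_fin.
(* The left-hand side of the energy inequality is at most [rd + N * e], which
   is at most [lam i * e / 4]. *)
have ale i : 4 * a' i <= e.
  rewrite -(ler_pM2l (lam0 i)); apply: le_trans (lame i).
  by have := lale i; lra.
(* The energy excess and the discrepancies each use half of [eps]. *)
have sumd : \sum_i d' i <= N%:R * e.
  by apply: sumNe => i; have := dle i; have := ale i; have := pe i; lra.
have sla0 : 0 <= \sum_i lam i * a' i.
  by apply: sumr_ge0 => i _; rewrite mulr_ge0// ltW.
have {}Hsrc := Hsrc ltac:(lra).
have key := energy_absorbs_discrepancy _ _ _ _ _ _ _ _ _ _ _ _
  b20 a0 lamb dle Hen Hsrc.
have -> : (\sum_i ((lam i)%:E * dl i + (p i)%:E))%E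
    = (\sum_i s i + \sum_i p i)%:E.
  by rewrite -big_split /= -sumEFin; apply: eq_bigr => i _; rewrite sE -EFinD.
have sp0 : 0 <= \sum_i p i by exact: sumr_ge0.
have ss0 : 0 <= \sum_i s i by exact: sumr_ge0.
have bound : \sum_i s i + 2 * b2 * \sum_i p i
    <= (1 + 2 * b2) * (\sum_i s i + \sum_i p i) by nra.
split.
  rewrite -EFinM lee_fin mulrAC ler_pdivlMr ?subr_gt0// mulrC.
  lra.
move=> j; rewrite aE -!EFinM lee_fin mulrCA ler_pdivlMl//.
have := lale j; nra.
Qed.

Lemma bregman_ge0 (K : realType) (X : normedModType K) (R : X -> \bar K)
    (xi : {linear X -> K^o}) (v u : X) :
  (0 <= R u)%E -> subgradient R u xi -> (0 <= bregman R xi v u)%E.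
Proof.
move=> Ru0 [_ Rufin /(_ v)]; rewrite /bregman.
have Rufin' : R u \is a fin_num by rewrite ge0_fin_numE.
by rewrite leeBrDr// add0e leeBrDr// addeC.
Qed.

(** Convergence of the data supplies, uniformly over the finitely many
    components, everything that S2 demands of them: membership in the
    neighbourhoods [V i] and discrepancy below [alpha]; continuity of [psi i]
    at 0 makes the resulting errors small. *)
Lemma near_S2_data (K : realType) (N : nat) (X : normedModType K)
    (Y : 'I_N -> normedModType K) (D : forall i, Y i -> Y i -> \bar K)
    (T : forall i, X -> Y i) (tD : forall i, Topological (Y i))
    (psi : 'I_N -> K -> K) (U : set X) (f : nat -> forall i, Y i)
    (fd : forall i, Y i) (e : K) :
  (forall i (a b : Y i), (0 <= D i a b)%E) ->
  Dcvg D tD f fd -> S2 D T tD psi U fd -> 0 < e ->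
  \forall n \near \oo, forall i,
    let p := psi i (fine (D i (fd i) (f n i))) in
    [/\ 0 <= p, p < e & forall v, U v ->
      (D i (T i v) (fd i) * (1 - p)%:E - p%:E <= D i (T i v) (f n i))%E].
Proof.
move=> D_ge0 fcvg HS2 e0; apply: filter_forall => i.
have [psimod [V [alpha [Vo Vfd alpha0 HV]]]] := HS2 i.
have [r r0 psir] := modulus_small _ _ _ psimod e0.
have [Dcv tcv] := fcvg i.
have fV : \forall n \near \oo, V (f n i).
  by apply: tcv; apply: open_nbhs_nbhs; split.
have Dr := near_lt_of_cvg0 _ _ _ Dcv r0.
have Da := near_lt_of_cvg0 _ _ _ Dcv alpha0.
have [_ _ psi_ge0 _] := psimod.
near=> n.
have Dnr : (D i (fd i) (f n i) < r%:E)%E by near: n.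
have Dn0 : 0 <= fine (D i (fd i) (f n i)) by exact: fine_ge0.
split.
- exact: psi_ge0.
- apply: psir => //.
  by rewrite -lte_fin fineK// ge0_fin_numE// (lt_trans Dnr)// ltry.
- move=> v Uv; have [] := HV v (f n i) Uv; [by near: n|by near: n|by []].
Unshelve. all: by end_near. Qed.

Theorem corollary2p14 (K : realType) (N : nat) (X : completeNormedModType K)
  (Y : 'I_N -> normedModType K)
  (R : X -> \bar K) (R_ge0 : forall u, (0 <= R u)%E)
  (D : forall i, Y i -> Y i -> \bar K)
  (D_ge0 : forall i (a b : Y i), (0 <= D i a b)%E)
  (domT : 'I_N -> set X) (T : forall i, X -> Y i)
  (tX : Topological X) (tX_hausdorff : hausdorff_space (withTop tX))
  (tY : forall i, Topological (Y i))
  (tY_hausdorff : forall i, hausdorff_space (withTop (tY i)))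
  (tD : forall i, Topological (Y i))
  (HG : assumption_G R D domT T tX tY tD)
  (fd : forall i, Y i) (f : nat -> forall i, Y i)
  (f_cvg : Dcvg D tD f fd)
  (delta : nat -> 'I_N -> \bar K)
  (deltaE : forall n i, delta n i = D i (fd i) (f n i))
  (lambda : nat -> 'I_N -> K)
  (lambda_gt0 : forall n i, 0 < lambda n i)
  (lambda_cvg : forall i, (fun n => lambda n i) @ \oo --> +oo)
  (lambda_delta_cvg :
     forall i, (fun n => ((lambda n i)%:E * delta n i)%E) @ \oo --> 0%E)
  (u : nat -> X)
  (u_min : forall n, is_J_minimizer R D domT T (lambda n) (f n) (u n))
  (ud : X) (ud_sol : is_R_minimizing_solution R domT T fd ud)
  (psi : 'I_N -> K -> K) (n0 : nat)
  (HS2 : S2 D T tD psi ([set u n | n in [set n | (n0 <= n)%N]] `|` [set ud])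
           fd) :
  (exists2 C : K, 0 < C & \forall n \near \oo,
     (R (u n) <= R ud + C%:E * \sum_(i < N) (lambda n i)%:E * delta n i)%E) /\
  (forall (xi : {linear X -> K^o}) (beta1 beta2 : K),
     subgradient R ud xi -> 0 < beta1 < 1 -> 0 < beta2 ->
     (exists2 eps : K, 0 < eps & forall v : X, domain domT v ->
        (R v + \sum_(i < N) D i (T i v) (fd i) <= R ud + eps%:E)%E ->
        ((- xi (v - ud))%:E <= beta1%:E * bregman R xi v ud
           + beta2%:E * \sum_(i < N) D i (T i v) (T i ud))%E) ->
     let rate n := (\sum_(i < N) ((lambda n i)%:E * delta n i
                                  + (psi i (fine (delta n i)))%:E))%E in
     bigO_seq (fun n => bregman R xi (u n) ud) rate /\
     forall j : 'I_N,
       bigO_seq (fun n => D j (T j (u n)) (f n j))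
         (fun n => (((lambda n j)^-1)%:E * rate n)%E)).
Proof.
have [_ Tud udfin _] := ud_sol.
have energy n := minimizer_energy_le _ _ _ _ _ _ _ _ _ _ _ _ _ (u_min n) ud_sol.
split.
  exists 1 => //; apply: nearW => n; rewrite mul1e addeC.
  under eq_bigr do rewrite deltaE.
  apply: le_trans (energy n); rewrite leeDr// sume_ge0// => i _.
  by rewrite mule_ge0// lee_fin ltW.
move=> xi beta1 beta2 xi_sub beta1_01 beta2_gt0 [eps eps0 Hsrc] rate.
(* [e / 4 <= 1 / 2] is needed to invert S2; the other bound makes [N] errors of
   size [e], counted twice, fit into [eps]; [N.+1] avoids dividing by 0. *)
pose e := Num.min 1 (eps / (2 * N.+1%:R)).
have eps' : 0 < eps / (2 * N.+1%:R) by rewrite divr_gt0// mulr_gt0.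
have e0 : 0 < e by rewrite lt_min ltr01.
have eN : 2 * N%:R * e <= eps.
  have : e <= eps / (2 * N.+1%:R) by rewrite ge_min lexx orbT.
  rewrite ler_pdivlMr ?mulr_gt0// -natr1; lra.
have e4 : 0 < e / 4 by lra.
have e1 : e <= 1 by rewrite ge_min lexx.
suff H : \forall n \near \oo,
  (bregman R xi (u n) ud <= ((1 + 2 * beta2) / (1 - beta1))%:E * rate n)%E /\
  forall j, (D j (T j (u n)) (f n j) <=
    (2 * (1 + 2 * beta2))%:E * (((lambda n j)^-1)%:E * rate n))%E.
  split=> [|j].
    exists ((1 + 2 * beta2) / (1 - beta1)); first by apply: divr_gt0; lra.
    by apply: filterS H => n [].
  exists (2 * (1 + 2 * beta2)); first by lra.
  by apply: filterS H => n [].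
have Hdata := near_S2_data _ _ _ _ _ _ _ _ _ _ _ _ D_ge0 f_cvg HS2 e4.
have Hweighted : \forall n \near \oo,
    forall i, ((lambda n i)%:E * delta n i < e%:E)%E.
  by apply: filter_forall => i; exact: near_lt_of_cvg0.
(* The first bound is for the absorption, the second for [a i <= e / 4]. *)
pose M := Num.max (4 * beta2) (4 * (fine (R ud) + N%:R * e) / e).
have Hlambda : \forall n \near \oo, forall i, M <= lambda n i.
  by apply: filter_forall => i; exact: (cvgryPge _).1.
apply: filterS2 (filterI Hdata Hweighted)
  (filterI Hlambda (nbhs_infty_ge n0)).
move=> n [dataU wlt] [Mlam n0n].
have data i : [/\ 0 <= psi i (fine (delta n i)),
    psi i (fine (delta n i)) < e / 4 &
    (D i (T i (u n)) (fd i) * (1 - psi i (fine (delta n i)))%:E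
       - (psi i (fine (delta n i)))%:E <= D i (T i (u n)) (f n i))%E].
  rewrite deltaE; have [p0 pe pU] := dataU i; split => //.
  by apply: pU; left; exists n.
have src := Hsrc (u n) (u_min n).1.
rewrite [X in (_ -> (_ <= _ + _ * X)%E)]
  (eq_bigr (fun i => D i (T i (u n)) (fd i))) in src;
  last by move=> i _; rewrite Tud.
apply: (error_bounds_of_energy K N (lambda n)
  (fun i => psi i (fine (delta n i)))
  (fun i => D i (T i (u n)) (f n i)) (fun i => D i (T i (u n)) (fd i))
  (delta n) (R (u n)) (R ud) (xi (u n - ud))
  beta1 beta2 e eps) => //.
- by move=> i; have [] := data i.
- by move=> i; rewrite deltaE.
- by case/andP: beta1_01.
- by under [in X in (_ <= X)%E]eq_bigr do rewrite deltaE.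
- by move=> i; have [] := data i.
- by move=> i; have [_ pe _] := data i; lra.
- by move=> i; have [_ pe _] := data i; lra.
- by move=> i; exact: ltW.
- by move=> i; apply: le_trans (Mlam i); rewrite le_max lexx.
- move=> i; rewrite -ler_pdivrMr//; apply: le_trans (Mlam i).
  by rewrite le_max lexx orbT.
- exact: bregman_ge0.
Qed.
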